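(* Let $0<|q|<1$ and let $a,b,c\in\mathbb{C}$ with $|a|<1$, $|b|<1$ and $c\notin\{-q^{-j-1}: j=0,1,2,\dots\}$. Then $$\sum_{n=0}^\infty\frac{(a;q)_n(b;q)_n}{(q;q)_n(ab;q^2)_n}q^{\frac{n(n+1)}{2}}c^n=\frac{(a;q)_\infty(b;q)_\infty(-cq;q)_\infty}{(ab;q^2)_\infty}\sum_{n=0}^\infty\frac{h_n(a,bq\,|\,q^2)+h_n(aq,b\,|\,q^2)}{(q;q)_n(-cq;q)_n(1+q^n)}.$$
   Context: For $x\in\mathbb{C}$: $(x;q)_\infty=\prod_{j\ge0}(1-xq^j)$ and $(x;q)_n=\prod_{j=0}^{n-1}(1-xq^j)$ for integers $n\ge0$; the same notation is used with base $q^2$. The $q$-binomial coefficient is $\genfrac{[}{]}{0pt}{}{n}{k}_{p}=\frac{(p;p)_n}{(p;p)_k(p;p)_{n-k}}$. The Rogers–Szegő polynomials are $h_n(a,b\,|\,p)=\sum_{k=0}^n\genfrac{[}{]}{0pt}{}{n}{k}_{p}a^kb^{n-k}$. *)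

(* Defs.v *)
From HB Require Import structures.
From mathcomp Require Import all_boot all_order all_algebra.
From mathcomp Require Import complex.
From mathcomp Require Import all_classical all_reals all_analysis.

Set Implicit Arguments.
Unset Strict Implicit.
Unset Printing Implicit Defensive.

Import Order.TTheory GRing.Theory Num.Theory.
Import numFieldNormedType.Exports.

Local Open Scope classical_set_scope.
Local Open Scope ring_scope.

(* Viewing R[i] as a numFieldType gives it the topology of the modulus,
   which is not inferred on the bare type R[i]. *)
Definition Cplx (R : realType) : numFieldType := R[i].

Definition qpoch (K : fieldType) (x q : K) (n : nat) : K :=
  \prod_(j < n) (1 - x * q ^+ j).

Definition qpoch_inf (K : numFieldType) (x q : K) : K :=
  limn (fun n => qpoch x q n).

Definition qbinom (K : fieldType) (p : K) (n k : nat) : K :=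
  qpoch p p n / (qpoch p p k * qpoch p p (n - k)).

Definition rogers_szego (K : fieldType) (n : nat) (a b p : K) : K :=
  \sum_(k < n.+1) qbinom p n k * a ^+ k * b ^+ (n - k).

(* Main.v *)
(* Euler's series [E(t) = sum_n w_n t^n], with [x = -cq] and
   [w_n = (-x)^n q^C(n,2) / (q;q)_n], satisfies [E(t) = (1 - x t) E(q t)], so
   [E(1) = (x;q)_m E(q^m)], and [E(q^m) --> 1] gives [(x;q)_oo = E(1)].

   Put [H_m = (h_m(a,bq|q^2) + h_m(aq,b|q^2)) / ((q;q)_m (1 + q^m))].  Expanding
   the Rogers-Szego polynomials gives
     [(1 - q^m) H_m = (a + b) H_(m-1) - a b (1 + q^(m-2)) H_(m-2)],
   so [phi(t) = sum_m H_m t^m] satisfies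
     [(1 - a b t^2) phi(q t) = (1 - a t)(1 - b t) phi(t)].
   Iterating at [t = 1], [phi(q^n) = phi(1) (a;q)_n (b;q)_n / (ab;q^2)_n], and
   [n --> oo] gives [phi(1) = (ab;q^2)_oo / ((a;q)_oo (b;q)_oo)].

   Hence the left-hand side times [phi(1)] is [sum_n w_n phi(q^n)]; exchanging
   the two summations turns it into [sum_m H_m E(q^m)], which is
   [(-cq;q)_oo sum_m H_m / (-cq;q)_m]. *)
Require Import Defs.
From HB Require Import structures.
From mathcomp Require Import all_boot all_order all_algebra.
From mathcomp Require Import complex.
From mathcomp Require Import all_classical all_reals all_analysis.
From mathcomp Require Import ring.

Import Order.TTheory GRing.Theory Num.Theory.
Import numFieldNormedType.Exports.

Local Open Scope classical_set_scope.
Local Open Scope ring_scope.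

Set Implicit Arguments.
Unset Strict Implicit.
Unset Printing Implicit Defensive.

(** * Absolutely summable complex series and dominated convergence *)

Definition abs_summable (K : numFieldType) (u : nat -> K) : Prop :=
  exists B : K, forall N, series (fun n => `|u n|) N <= B.

Lemma real_le_cvgn (R : realType) (x : nat -> R) (B : R) :
  (forall N, series (fun n => `|x n|) N <= B) -> cvgn (series x).
Proof.
move=> hB; apply: normed_cvg; apply: nondecreasing_is_cvgn.
  by apply: nondecreasing_series => n _ _; exact: normr_ge0.
by exists B => _ [n _ <-]; exact: hB.
Qed.

Lemma Re_series (R : realType) (u : nat -> Cplx R) N :
  complex.Re (series u N) = series (fun n => complex.Re (u n)) N.
Proof.
elim: N => [|N IH]; first by rewrite /series /= !big_geq.
by rewrite !seriesSr -IH; case: (series u N) (u N) => [? ?] [? ?].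
Qed.

Lemma Im_series (R : realType) (u : nat -> Cplx R) N :
  complex.Im (series u N) = series (fun n => complex.Im (u n)) N.
Proof.
elim: N => [|N IH]; first by rewrite /series /= !big_geq.
by rewrite !seriesSr -IH; case: (series u N) (u N) => [? ?] [? ?].
Qed.

Lemma cvg_ReIm (R : realType) (z : nat -> Cplx R) (x y : R) :
  complex.Re (z n) @[n --> \oo] --> x -> complex.Im (z n) @[n --> \oo] --> y ->
  z n @[n --> \oo] --> (Complex x y : Cplx R).
Proof.
move=> hx hy; apply/cvgrPdist_lt => e e0.
(* A positive element of [R[i]] has zero imaginary part. *)
have [er epos] : e = (complex.Re e)%:C%C /\ 0 < complex.Re e.
  by move: e0; case: e => er ei; rewrite ltcE /= => /andP[/eqP -> ->].
have h2 : 0 < complex.Re e / 2 by rewrite divr_gt0.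
move/cvgrPdist_lt : hx => /(_ _ h2) hx; move/cvgrPdist_lt : hy => /(_ _ h2) hy.
near=> n.
have h1 : `|x - complex.Re (z n)| < complex.Re e / 2 by near: n; exact: hx.
have h3 : `|y - complex.Im (z n)| < complex.Re e / 2 by near: n; exact: hy.
have -> : (Complex x y : Cplx R) - z n =
   (x - complex.Re (z n))%:C%C + 'i%C * (y - complex.Im (z n))%:C%C.
  by case: (z n) => a b /=; simpc.
apply: le_lt_trans (ler_normD _ _) _.
rewrite normrM !normc_def /= !expr0n /= !addr0 add0r expr1n sqrtr1 mul1r !sqrtr_sqr.
by rewrite er -rmorphD /= ltcR [ltRHS]splitr ltrD.
Unshelve. all: by end_near. Qed.

(** Real and imaginary parts are bounded by the modulus, so both component series converge
    absolutely over the reals. *)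
Lemma abs_summable_cvgn (R : realType) (u : nat -> Cplx R) :
  abs_summable u -> cvgn (series u).
Proof.
move=> [B hB].
have part (f : Cplx R -> R) : (forall z, `|f z|%:C%C <= `|z|) ->
    cvgn (series (fun n => f (u n))).
  move=> hf; apply: (@real_le_cvgn _ _ (complex.Re B)) => N.
  have : (series (fun n => `|f (u n)|) N)%:C%C <= series (fun n => `|u n|) N.
    rewrite /series /= rmorph_sum; apply: ler_sum => i _; exact: hf.
  move=> /le_trans /(_ (hB N)); by rewrite lecE /= => /andP[].
have /cvg_ex [x hx] := part _ (@normc_ge_Re R).
have hIm (z : Cplx R) : `|complex.Im z|%:C%C <= `|z|.
  rewrite normc_def lecR -sqrtr_sqr ler_sqrt ?addr_ge0 ?sqr_ge0 //.
  by rewrite lerDr sqr_ge0.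
have /cvg_ex [y hy] := part _ hIm.
apply/cvg_ex; exists (Complex x y); apply: cvg_ReIm.
  by under eq_fun do rewrite Re_series.
by under eq_fun do rewrite Im_series.
Qed.

Lemma abs_summable_le (K : numFieldType) (u v : nat -> K) :
  (forall n, `|u n| <= `|v n|) -> abs_summable v -> abs_summable u.
Proof.
move=> h [B hB]; exists B => N; apply: le_trans (hB N).
by rewrite /series /= ler_sum.
Qed.

Lemma abs_summableZ (K : numFieldType) (k : K) (u : nat -> K) :
  abs_summable u -> abs_summable (fun n => k * u n).
Proof.
move=> [B hB]; exists (`|k| * B) => N.
rewrite /series /=; under eq_bigr do rewrite normrM.
by rewrite -mulr_sumr; apply: ler_wpM2l => //; exact: hB.
Qed.

Lemma cvgn_lim (K : numFieldType) (u : nat -> K) (l : K) :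
  u n @[n --> \oo] --> l -> limn u = l.
Proof. by move=> h; apply: cvg_lim h; exact: norm_hausdorff. Qed.

Lemma cvgn_eq (K : numFieldType) (u : nat -> K) (l1 l2 : K) :
  u n @[n --> \oo] --> l1 -> u n @[n --> \oo] --> l2 -> l1 = l2.
Proof. by move=> h1 h2; apply: (cvg_unique _ h1 h2); exact: norm_hausdorff. Qed.

Lemma cvg_seriesZ (K : numFieldType) (k : K) (u : nat -> K) (l : K) :
  series u n @[n --> \oo] --> l ->
  series (fun n => k * u n) n @[n --> \oo] --> k * l.
Proof.
move=> h.
have -> : series (fun n => k * u n) = (fun n => k * series u n).
  by apply/funext => n; rewrite /series /= mulr_sumr.
by apply: cvgM h; exact: cvg_cst.
Qed.

Lemma cvg_series_eval (K : numFieldType) (u : nat -> nat -> K) (v : nat -> K) N :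
  (forall m, u n m @[n --> \oo] --> v m) ->
  series (u n) N @[n --> \oo] --> series v N.
Proof.
move=> h; elim: N => [|N IH].
  rewrite [series v 0]big_geq //; under eq_fun do rewrite /series /= big_geq //.
  exact: cvg_cst.
rewrite seriesSr; under eq_fun do rewrite seriesSr.
exact: cvgD.
Qed.

(** Beyond [N] the partial sums of [u] move no more than those of the norms of [M], so an index
    found for [M] alone serves every [u] at once. *)
Lemma series_tail_le (R : realType) (M : nat -> Cplx R) (e : Cplx R) :
  abs_summable M -> 0 < e -> exists N, forall u : nat -> Cplx R,
    (forall m, `|u m| <= `|M m|) -> `|limn (series u) - series u N| < e.
Proof.
move=> hM e0.
have hMa : abs_summable (fun n => `|M n|).
  by apply: abs_summable_le hM => n; rewrite normr_id.
have /cvg_ex [S hS] := abs_summable_cvgn hMa.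
have e3 : 0 < e / 3 by rewrite divr_gt0.
move/cvgrPdist_lt : hS => /(_ _ e3) [N _ hN].
exists N => u hu.
have hu' : series u n @[n --> \oo] --> limn (series u).
  exact: abs_summable_cvgn (abs_summable_le hu hM).
move/cvgrPdist_lt : hu' => /(_ _ e3) [k _ hk].
(* Only [k] depends on [u]: past it the partial sum is within [e / 3] of the limit, and the other
   two thirds bound the block from [N] to [n]. *)
set n := maxn N k.
have h1 := hk n (leq_maxr _ _); have h2 := hN n (leq_maxl _ _).
have h3 := hN N (leqnn _).
have h4 : `|series u n - series u N| <=
    series (fun m => `|M m|) n - series (fun m => `|M m|) N.
  rewrite !sub_series_geq ?leq_maxl //.
  by apply: le_trans (ler_norm_sum _ _ _) _; apply: ler_sum.
have -> : limn (series u) - series u N =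
  (limn (series u) - series u n) + (series u n - series u N) by ring.
apply: le_lt_trans (ler_normD _ _) _.
have -> : e = e / 3 + (e / 3 + e / 3) by field.
apply: ltrD => //; apply: le_lt_trans h4 _.
apply: le_lt_trans (_ : `|series (fun m => `|M m|) n - series (fun m => `|M m|) N| < _).
  rewrite ger0_norm // sub_series_geq ?leq_maxl //.
  by apply: sumr_ge0 => *.
have -> : series (fun m => `|M m|) n - series (fun m => `|M m|) N =
  (S - series (fun m => `|M m|) N) - (S - series (fun m => `|M m|) n) by ring.
by apply: le_lt_trans (ler_normB _ _) _; apply: ltrD.
Qed.

(** Tannery's theorem: the tails beyond some [N] are uniformly small, and the first [N] terms
    converge one by one. *)
Lemma dominated_cvg_limn_series (R : realType) (u : nat -> nat -> Cplx R)
    (v M : nat -> Cplx R) :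
  abs_summable M -> (forall n m, `|u n m| <= `|M m|) ->
  (forall m, u n m @[n --> \oo] --> v m) ->
  limn (series (u n)) @[n --> \oo] --> limn (series v).
Proof.
move=> hM hu huv.
have hv m : `|v m| <= `|M m|.
  rewrite real_leNgt //; apply/negP => lt_Mv.
  have /cvgrPdist_lt : u n m @[n --> \oo] --> v m := huv m.
  have d0 : 0 < `|v m| - `|M m| by rewrite subr_gt0.
  move=> /(_ _ d0) [n _ /(_ n (leqnn n)) /= hn].
  have : `|v m| < `|v m|.
    rewrite -{1}(subrK (u n m) (v m)); apply: le_lt_trans (ler_normD _ _) _.
    by rewrite -[ltRHS](subrK `|M m|) ltr_leD.
  by rewrite ltxx.
apply/cvgrPdist_lt => e e0.
have e3 : 0 < e / 3 by rewrite divr_gt0.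
have [N hN] := series_tail_le hM e3.
have /cvgrPdist_lt /(_ _ e3) hs := cvg_series_eval (N := N) huv.
near=> n.
have h1 : `|series v N - series (u n) N| < e / 3 by near: n; exact: hs.
have -> : limn (series v) - limn (series (u n)) =
  (limn (series v) - series v N) +
  ((series v N - series (u n) N) - (limn (series (u n)) - series (u n) N)).
  by ring.
have -> : e = e / 3 + (e / 3 + e / 3) by field.
apply: le_lt_trans (ler_normD _ _) _; apply: ltrD; first exact: hN.
apply: le_lt_trans (ler_normB _ _) _; apply: ltrD => //; exact: hN.
Unshelve. all: by end_near. Qed.

Lemma ratio_abs_summable (K : numFieldType) (u : nat -> K) (N : nat) :
  (forall n, (N <= n)%N -> `|u n.+1| <= `|u n| / 2) -> abs_summable u.
Proof.
move=> h; exists (series (fun n => `|u n|) N + 2 * `|u N|) => n.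
(* Each term is at most half its predecessor, so the partial sum plus twice the next term never
   increases. *)
have bound k : series (fun n => `|u n|) (N + k)%N + 2 * `|u (N + k)%N| <=
    series (fun n => `|u n|) N + 2 * `|u N|.
  elim: k => [|k]; first by rewrite addn0 lexx.
  apply: le_trans; rewrite addnS seriesSr -addrA lerD2l.
  have -> : 2 * `|u (N + k)%N| = `|u (N + k)%N| + 2 * (`|u (N + k)%N| / 2) by field.
  by rewrite lerD2l; apply: ler_wpM2l => //; apply: h; exact: leq_addr.
apply: le_trans (bound n); apply: le_trans (_ : series (fun n => `|u n|) (N + n)%N <= _).
  by rewrite -subr_ge0 sub_series_geq ?leq_addl ?sumr_ge0.
by rewrite lerDl; apply: mulr_ge0.
Qed.

Lemma abs_summable_geometric (K : numFieldType) (q : K) :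
  `|q| < 1 -> abs_summable (fun n => q ^+ n).
Proof.
move=> q1; exists (1 - `|q|)^-1 => N.
have d0 : 0 < 1 - `|q| by rewrite subr_gt0.
rewrite -[leRHS]mul1r ler_pdivlMr //.
have -> : series (fun n => `|q ^+ n|) N * (1 - `|q|) = 1 - `|q| ^+ N.
  elim: N => [|N IH]; first by rewrite /series /= big_geq // mul0r expr0 subrr.
  by rewrite seriesSr mulrDl IH normrX exprS; ring.
by rewrite gerBl exprn_ge0.
Qed.

Lemma cvg_exprn (R : realType) (q : Cplx R) :
  `|q| < 1 -> q ^+ n @[n --> \oo] --> (0 : Cplx R).
Proof.
by move=> q1; apply: cvg_series_cvg_0; apply: abs_summable_cvgn; exact: abs_summable_geometric.
Qed.

(** * Finite q-products and the coefficients of Euler's series *)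

Lemma qpoch0 (K : fieldType) (x q : K) : qpoch x q 0 = 1.
Proof. by rewrite /qpoch big_ord0. Qed.

Lemma qpochS (K : fieldType) (x q : K) n :
  qpoch x q n.+1 = qpoch x q n * (1 - x * q ^+ n).
Proof. by rewrite /qpoch big_ord_recr. Qed.

Lemma qpoch_neq0 (K : numFieldType) (x q : K) n :
  `|x| < 1 -> `|q| < 1 -> qpoch x q n != 0.
Proof.
move=> x1 q1; apply/prodf_neq0 => j _; apply/negP; rewrite subr_eq0 => /eqP h.
have : `|x * q ^+ j| < 1.
  rewrite normrM normrX; apply: le_lt_trans x1.
  by rewrite ler_piMr // exprn_ile1 // ltW.
by rewrite -h normr1 ltxx.
Qed.

Lemma norm_subr1X_ge (K : numFieldType) (q : K) n :
  `|q| < 1 -> 1 - `|q| <= `|1 - q ^+ n.+1|.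
Proof.
move=> q1; apply: le_trans (_ : 1 - `|q ^+ n.+1| <= _).
  rewrite lerB // normrX exprS ler_piMr // exprn_ile1 // ltW //.
by have := lerB_dist 1 (q ^+ n.+1); rewrite normr1.
Qed.

Lemma subr1X_neq0 (K : numFieldType) (q : K) n :
  `|q| < 1 -> 1 - q ^+ n.+1 != 0.
Proof.
move=> q1; rewrite -normr_gt0; apply: lt_le_trans (norm_subr1X_ge n q1).
by rewrite subr_gt0.
Qed.

(* Coefficients of Euler's expansion of [(x t; q)_oo] in powers of [t]. *)
Definition euler_coef (K : fieldType) (x q : K) (n : nat) : K :=
  (- x) ^+ n * q ^+ 'C(n, 2) / qpoch q q n.

Lemma euler_coefS (K : numFieldType) (x q : K) n : `|q| < 1 ->
  (1 - q ^+ n.+1) * euler_coef x q n.+1 = - x * q ^+ n * euler_coef x q n.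
Proof.
move=> q1; rewrite /euler_coef qpochS -exprS binS bin1 exprD [(- x) ^+ n.+1]exprS.
have h1 := subr1X_neq0 n q1; have h2 := qpoch_neq0 n q1 q1.
by field; rewrite h1 h2.
Qed.

(** Consecutive coefficients have ratio [- x * q ^+ n / (1 - q ^+ n.+1)]. The numerator tends to 0
    and the denominator has modulus at least 1 - |q|, so the ratio eventually has modulus at most
    1/2. *)
Lemma euler_coef_abs_summable (R : realType) (x q : Cplx R) : `|q| < 1 ->
  abs_summable (euler_coef x q).
Proof.
move=> q1; have d0 : 0 < (1 - `|q|) / 2 by rewrite divr_gt0 ?subr_gt0.
have : - x * q ^+ n @[n --> \oo] --> (- x * 0 : Cplx R).
  by apply: cvgM; [exact: cvg_cst|exact: cvg_exprn].
rewrite mulr0 => /cvgr0Pnorm_lt /(_ _ d0) [N _ hN].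
apply: (@ratio_abs_summable _ _ N) => n /hN /= hn.
have h1 : 0 < 1 - `|q| by rewrite subr_gt0.
rewrite -(ler_pM2l h1).
apply: le_trans (_ : `|1 - q ^+ n.+1| * `|euler_coef x q n.+1| <= _).
  by rewrite ler_wpM2r // norm_subr1X_ge.
rewrite -normrM euler_coefS // normrM.
have -> : (1 - `|q|) * (`|euler_coef x q n| / 2) =
  (1 - `|q|) / 2 * `|euler_coef x q n| by field.
by rewrite ler_wpM2r // ltW.
Qed.

(** * Power series at the points q^n, and infinite products *)

Definition psum (K : numFieldType) (u : nat -> K) (t : K) : K :=
  limn (series (fun n => u n * t ^+ n)).

Lemma norm_mulX_le (K : numFieldType) (u : nat -> K) (t : K) n :
  `|t| <= 1 -> `|u n * t ^+ n| <= `|u n|.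
Proof. by move=> t1; rewrite normrM normrX ler_piMr // exprn_ile1. Qed.

Lemma psum_cvg (R : realType) (u : nat -> Cplx R) (t : Cplx R) :
  abs_summable u -> `|t| <= 1 ->
  series (fun n => u n * t ^+ n) n @[n --> \oo] --> psum u t.
Proof.
move=> hu t1; apply: abs_summable_cvgn.
by apply: abs_summable_le hu => n; exact: norm_mulX_le.
Qed.

(** Dominated convergence with majorant |u_m|: every positive power of q^n tends to 0. *)
Lemma psum_cvg0 (R : realType) (u : nat -> Cplx R) (q : Cplx R) :
  abs_summable u -> `|q| < 1 -> psum u (q ^+ n) @[n --> \oo] --> u 0%N.
Proof.
move=> hu q1.
(* The limit is rewritten as the power series at 0, where [0 ^+ 0 = 1] keeps the constant term. *)
have -> : u 0%N = limn (series (fun m => u m * 0 ^+ m)).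
  symmetry; apply: cvgn_lim; rewrite -(cvg_shiftn 1).
  have -> : [sequence series (fun m => u m * 0 ^+ m) (n + 1)%N]_n = (fun=> u 0%N).
    apply/funext => n /=; rewrite addn1 /series /= big_nat_recl //= expr0 mulr1.
    by rewrite big1 ?addr0 // => i _; rewrite exprS mul0r mulr0.
  exact: cvg_cst.
apply: (dominated_cvg_limn_series hu) => [n m|m].
  by apply: norm_mulX_le; rewrite normrX exprn_ile1 // ltW.
apply: cvgM; first exact: cvg_cst.
case: m => [|m]; first by under eq_fun do rewrite expr0; exact: cvg_cst.
under eq_fun do rewrite -exprM mulnC exprM.
rewrite expr0n /=; apply: cvg_exprn.
by rewrite normrX exprn_ilt1 // ltW.
Qed.

Lemma cvgnS (K : numFieldType) (u : nat -> K) (l : K) :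
  u n @[n --> \oo] --> l -> u n.+1 @[n --> \oo] --> l.
Proof. by move=> h; rewrite (cvg_shiftS u). Qed.

Lemma psum_euler_shift (R : realType) (x q t : Cplx R) :
  `|q| < 1 -> `|t| <= 1 ->
  psum (euler_coef x q) t = (1 - x * t) * psum (euler_coef x q) (q * t).
Proof.
move=> q1 t1; have hw := euler_coef_abs_summable x q1.
have qt1 : `|q * t| <= 1 by rewrite normrM mulr_ile1 // ltW.
set w := euler_coef x q in hw *.
(* The functional equation is exact on partial sums once the sum multiplied by [t] is cut one term
   earlier, since that factor raises the degree by one. *)
have step N : series (fun n => w n * t ^+ n) N.+1 =
    series (fun n => w n * (q * t) ^+ n) N.+1
      - x * t * series (fun n => w n * (q * t) ^+ n) N.
  elim: N => [|N IH]; first by rewrite !seriesSr /series /= !big_geq //; ring.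
  rewrite seriesSr IH [in RHS]seriesSr [series _ N.+1 in X in _ = _ - X]seriesSr.
  have := euler_coefS x N q1; rewrite -/w => hS.
  have -> : w N.+1 * t ^+ N.+1 =
     (1 - q ^+ N.+1) * w N.+1 * t ^+ N.+1 + w N.+1 * (q * t) ^+ N.+1.
    by rewrite exprMn; ring.
  by rewrite hS !exprMn !exprS; ring.
have h1 := psum_cvg hw t1; have h2 := psum_cvg hw qt1.
apply: (cvgn_eq (cvgnS h1)); under eq_fun do rewrite step.
rewrite mulrBl mul1r; apply: cvgB; first exact: (cvgnS h2).
by apply: cvgM h2; exact: cvg_cst.
Qed.

Lemma psum_euler_qpoch (R : realType) (x q : Cplx R) n : `|q| < 1 ->
  psum (euler_coef x q) 1 = qpoch x q n * psum (euler_coef x q) (q ^+ n).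
Proof.
move=> q1; elim: n => [|n IH]; first by rewrite qpoch0 mul1r expr0.
have qn1 : `|q ^+ n| <= 1 by rewrite normrX exprn_ile1 // ltW.
by rewrite IH (psum_euler_shift x q1 qn1) qpochS -mulrA -exprS.
Qed.

Lemma euler_coef0 (K : fieldType) (x q : K) : euler_coef x q 0 = 1.
Proof. by rewrite /euler_coef qpoch0 !expr0 mulr1 divr1. Qed.

Lemma psum_euler_cvg1 (R : realType) (x q : Cplx R) : `|q| < 1 ->
  psum (euler_coef x q) (q ^+ n) @[n --> \oo] --> (1 : Cplx R).
Proof.
move=> q1; rewrite -(euler_coef0 x q); apply: psum_cvg0 => //.
exact: euler_coef_abs_summable.
Qed.

(* [E(1) = (x;q)_n E(q^n)] with [E(q^n) --> 1]: this yields the limit of the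
   products without any estimate on them. *)
Lemma qpoch_cvg (R : realType) (x q : Cplx R) : `|q| < 1 ->
  qpoch x q n @[n --> \oo] --> psum (euler_coef x q) 1.
Proof.
move=> q1; have h := psum_euler_cvg1 x q1.
set E := psum (euler_coef x q) in h *.
have hE : E 1 * (E (q ^+ n))^-1 @[n --> \oo] --> E 1.
  have -> : E 1 = E 1 * 1^-1 by rewrite invr1 mulr1.
  apply: cvgM; [rewrite invr1 mulr1; exact: cvg_cst|apply: cvgV => //; exact: oner_neq0].
(* The quotient is identified with [qpoch x q n] only for large [n], where [E (q ^+ n)] is close to
   1 and hence nonzero. *)
apply: cvg_trans hE; apply: near_eq_cvg.
move/cvgrPdist_lt : h => /(_ _ ltr01) hn.
near=> n.
have hn1 : `|1 - E (q ^+ n)| < 1 by near: n.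
have hn0 : E (q ^+ n) != 0.
  by apply: contraTneq hn1 => ->; rewrite subr0 normr1 ltxx.
by rewrite /E (psum_euler_qpoch x n q1) mulfK.
Unshelve. all: by end_near. Qed.

Lemma qpoch_infE (R : realType) (x q : Cplx R) : `|q| < 1 ->
  qpoch_inf x q = psum (euler_coef x q) 1.
Proof. by move=> q1; apply: cvgn_lim; exact: qpoch_cvg. Qed.

Lemma qpoch_inf_cvg (R : realType) (x q : Cplx R) : `|q| < 1 ->
  qpoch x q n @[n --> \oo] --> qpoch_inf x q.
Proof. by move=> q1; rewrite qpoch_infE //; exact: qpoch_cvg. Qed.

(** If E(1) vanished, then E(1) = (x;q)_n E(q^n) would make every E(q^n) zero, against E(q^n) -->
    1. *)
Lemma qpoch_inf_neq0 (R : realType) (x q : Cplx R) : `|q| < 1 ->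
  (forall n, qpoch x q n != 0) -> qpoch_inf x q != 0.
Proof.
move=> q1 h; rewrite qpoch_infE //; apply/negP => /eqP E0.
have : psum (euler_coef x q) (q ^+ n) @[n --> \oo] --> (0 : Cplx R).
  rewrite (_ : (fun n => _) = fun=> 0); first exact: cvg_cst.
  apply/funext => n; apply: (mulfI (h n)).
  by rewrite -psum_euler_qpoch // E0 mulr0.
move=> /(cvgn_eq (psum_euler_cvg1 x q1)) /eqP.
by rewrite oner_eq0.
Qed.

(** * Recurrence for the Rogers-Szego coefficients *)

Lemma qpoch_sqr (K : fieldType) (q : K) n :
  qpoch (q ^+ 2) (q ^+ 2) n = qpoch q q n * qpoch (- q) q n.
Proof.
elim: n => [|n IH]; first by rewrite !qpoch0 mulr1.
by rewrite !qpochS IH -exprM mul2n -addnn exprD; ring.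
Qed.

(** The sum of the two Rogers-Szego polynomials divided by (q^2;q^2)_n; the extra q on [a] or on [b]
    contributes q^k or q^(n-k). *)
Definition rs_sum (K : fieldType) (q a b : K) (n : nat) : K :=
  \sum_(k < n.+1) (q ^+ k + q ^+ (n - k)) * a ^+ k * b ^+ (n - k)
    / (qpoch (q ^+ 2) (q ^+ 2) k * qpoch (q ^+ 2) (q ^+ 2) (n - k)).

Lemma rs_sum0 (K : fieldType) (q a b : K) : rs_sum q a b 0 = 2.
Proof.
by rewrite /rs_sum big_ord1 !qpoch0 !expr0 !mulr1 divr1.
Qed.

Lemma rogers_szego_rs_sum (K : fieldType) (q a b : K) n :
  rogers_szego n a (b * q) (q ^+ 2) + rogers_szego n (a * q) b (q ^+ 2)
    = qpoch (q ^+ 2) (q ^+ 2) n * rs_sum q a b n.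
Proof.
rewrite /rogers_szego /rs_sum -big_split mulr_sumr; apply: eq_bigr => k _ /=.
by rewrite /qbinom !exprMn; ring.
Qed.

Lemma rs_sum_rec (K : numFieldType) (q a b : K) n :
  q != 0 -> `|q| < 1 ->
  (1 + q ^+ n.+1) * (1 - q ^+ n.+2) * rs_sum q a b n.+2 =
    (a + b) * rs_sum q a b n.+1 - a * b * rs_sum q a b n.
Proof.
move=> q0 q1.
have p1 : `|q ^+ 2| < 1 by rewrite normrX exprn_ilt1.
set P := qpoch (q ^+ 2) (q ^+ 2).
have P0 m : P m != 0 by exact: qpoch_neq0.
have PS m : P m.+1 = P m * (1 - q ^+ m.+1 ^+ 2).
  by rewrite /P qpochS -exprS -!exprM mulnC.
have N0 m : 1 - q ^+ m.+1 ^+ 2 != 0.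
  by apply: contraNneq (P0 m.+1) => h; rewrite PS h mulr0.
have qS m : q ^+ m.+1 / q = q ^+ m by rewrite exprSr mulfK.
(* Writing q^(k-1) as [q ^+ k / q] keeps the formula meaningful at [k = 0]. *)
pose X k l := (q ^+ k / q + q ^+ l) * (1 - q ^+ k ^+ 2) * a ^+ k * b ^+ l / (P k * P l).
pose Y k l := (q ^+ k + q ^+ l / q) * (1 - q ^+ l ^+ 2) * a ^+ k * b ^+ l / (P k * P l).
pose Z k l := (q ^+ k / q + q ^+ l / q) * (1 - q ^+ k ^+ 2) * (1 - q ^+ l ^+ 2)
  * a ^+ k * b ^+ l / (P k * P l).
(* With x = q^k and y = q^l this is the identity
   (1 - xy)(q + xy)(x + y) = (x + qy)(1 - x^2) + (qx + y)(1 - y^2)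
     - (x + y)(1 - x^2)(1 - y^2).
   The factors 1 - x^2 and 1 - y^2 vanish at k = 0 and l = 0, so the three
   sums below shift without boundary terms. *)
have split3 : (1 + q ^+ n.+1) * (1 - q ^+ n.+2) * rs_sum q a b n.+2 =
    \sum_(k < n.+3) X k (n.+2 - k)%N + \sum_(k < n.+3) Y k (n.+2 - k)%N
      - \sum_(k < n.+3) Z k (n.+2 - k)%N.
  rewrite /rs_sum mulr_sumr -big_split -sumrB; apply: eq_bigr => k _ /=.
  have hk : q ^+ n.+2 = q ^+ k * q ^+ (n.+2 - k) by rewrite -exprD subnKC // -ltnS.
  have hk1 : q ^+ n.+1 = q ^+ k * q ^+ (n.+2 - k) / q by rewrite -hk qS.
  rewrite hk hk1 /X /Y /Z -/P; move: (q ^+ k) (q ^+ (n.+2 - k)) => x y.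
  by field; rewrite !P0.
have X0 l : X 0%N l = 0 by rewrite /X !expr0 expr1n subrr !(mulr0, mul0r).
have Y0 k : Y k 0%N = 0 by rewrite /Y !expr0 expr1n subrr !(mulr0, mul0r).
have Z0l l : Z 0%N l = 0 by rewrite /Z !expr0 expr1n subrr !(mulr0, mul0r).
have Z0r k : Z k 0%N = 0 by rewrite /Z !expr0 expr1n subrr !(mulr0, mul0r).
(* After the shift of [k], the factor 1 - q^(2k+2) cancels the last factor of [P k.+1]; the other
   two sums reduce in the same way. *)
have eX : \sum_(k < n.+3) X k (n.+2 - k)%N = a * rs_sum q a b n.+1.
  rewrite big_ord_recl X0 add0r /rs_sum mulr_sumr; apply: eq_bigr => k _ /=.
  rewrite /bump /= add1n subSS /X -/P PS.
  rewrite qS [a ^+ _.+1]exprS.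
  by field; rewrite !P0 N0.
have eY : \sum_(k < n.+3) Y k (n.+2 - k)%N = b * rs_sum q a b n.+1.
  rewrite big_ord_recr /= subnn Y0 addr0 /rs_sum mulr_sumr; apply: eq_bigr => k _ /=.
  rewrite subSn; last by rewrite -ltnS.
  rewrite /Y -/P PS.
  rewrite qS [b ^+ _.+1]exprS.
  by field; rewrite !P0 N0.
have eZ : \sum_(k < n.+3) Z k (n.+2 - k)%N = a * b * rs_sum q a b n.
  rewrite big_ord_recl Z0l add0r big_ord_recr /= /bump /= !add1n subnn Z0r addr0.
  rewrite /rs_sum mulr_sumr; apply: eq_bigr => k _ /=.
  rewrite add1n subSS subSn; last by rewrite -ltnS.
  rewrite /Z -/P !PS.
  rewrite qS [a ^+ _.+1]exprS.
  rewrite qS [b ^+ _.+1]exprS.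
  by field; rewrite !P0 !N0.
by rewrite split3 eX eY eZ; ring.
Qed.

(** The numbers called H_m in the opening account. *)
Definition rs_coef (K : fieldType) (q a b : K) (n : nat) : K :=
  (rogers_szego n a (b * q) (q ^+ 2) + rogers_szego n (a * q) b (q ^+ 2))
    / (qpoch q q n * (1 + q ^+ n)).

Lemma add1X_neq0 (K : numFieldType) (q : K) n : `|q| < 1 -> 1 + q ^+ n != 0.
Proof.
move=> q1; case: n => [|n]; first by rewrite expr0 -[1 + 1]/(2%:R) pnatr_eq0.
apply/negP; rewrite addrC addr_eq0 => /eqP h.
have : `|q ^+ n.+1| < 1 by rewrite normrX exprn_ilt1.
by rewrite h normrN normr1 ltxx.
Qed.

(** Factoring (q^2;q^2)_n = (q;q)_n (-q;q)_n cancels the denominator (q;q)_n. *)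
Lemma rs_coefE (K : numFieldType) (q a b : K) n : `|q| < 1 ->
  rs_coef q a b n = qpoch (- q) q n / (1 + q ^+ n) * rs_sum q a b n.
Proof.
move=> q1; rewrite /rs_coef rogers_szego_rs_sum qpoch_sqr.
have h1 := add1X_neq0 n q1; have h2 := qpoch_neq0 n q1 q1.
by field; rewrite h1 h2.
Qed.

Lemma rs_coef0 (K : numFieldType) (q a b : K) : `|q| < 1 -> rs_coef q a b 0 = 1.
Proof.
move=> q1; have h := add1X_neq0 0 q1; rewrite expr0 in h.
by rewrite rs_coefE // rs_sum0 qpoch0 expr0 mul1r; exact: mulVf.
Qed.

Lemma rs_coef1 (K : numFieldType) (q a b : K) : `|q| < 1 ->
  (1 - q) * rs_coef q a b 1 = a + b.
Proof.
move=> q1; have p1 : `|q ^+ 2| < 1 by rewrite normrX exprn_ilt1.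
have h1 := add1X_neq0 1 q1; rewrite expr1 in h1.
have h2 := subr1X_neq0 0 q1; rewrite expr1 in h2.
rewrite rs_coefE // /rs_sum !big_ord_recl big_ord0 /= !qpochS !qpoch0 /=.
have h3 : 1 - q ^+ 2 != 0 by rewrite -[1](expr1n _ 2) subr_sqr mulf_neq0.
rewrite /bump /= ?addn0 ?subn0 ?subnn ?expr0 ?expr1 ?mulr1 ?mul1r.
by field; rewrite ?h1 ?h2 ?h3.
Qed.

Lemma rs_coef_rec (K : numFieldType) (q a b : K) n :
  q != 0 -> `|q| < 1 ->
  (1 - q ^+ n.+2) * rs_coef q a b n.+2 =
    (a + b) * rs_coef q a b n.+1 - a * b * (1 + q ^+ n) * rs_coef q a b n.
Proof.
move=> q0 q1; rewrite !rs_coefE //.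
have h0 := add1X_neq0 n q1; have h1 := add1X_neq0 n.+1 q1.
have h2 := add1X_neq0 n.+2 q1.
rewrite !qpochS !mulNr !opprK -!exprS.
have := rs_sum_rec a b n q0 q1.
set s0 := rs_sum q a b n; set s1 := rs_sum q a b n.+1; set s2 := rs_sum q a b n.+2.
move=> hs.
(* The last factor of (-q;q)_(n+2) cancels [1 + q ^+ n.+2], leaving (-q;q)_n times the left-hand
   side of [rs_sum_rec]. *)
transitivity (qpoch (- q) q n * ((1 + q ^+ n.+1) * (1 - q ^+ n.+2) * s2)).
  by field.
by rewrite hs; field; rewrite h0 h1.
Qed.

(** * Absolute summability of the Rogers-Szego coefficients *)

Lemma cvgn_normr_le (K : numFieldType) (u : nat -> K) (l : K) :
  u n @[n --> \oo] --> l -> exists B : K, forall n, `|u n| <= B.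
Proof.
move=> h; have /cvg_seq_bounded/pinfty_ex_gt0 [B _ hB] : cvgn u by apply/cvg_ex; exists l.
by exists B => n; exact: hB.
Qed.

(** The infinite product is nonzero, so the reciprocals converge and are therefore bounded. *)
Lemma qpoch_inv_bounded (R : realType) (x q : Cplx R) : `|x| < 1 -> `|q| < 1 ->
  exists B : Cplx R, forall n, `|(qpoch x q n)^-1| <= B.
Proof.
move=> x1 q1; apply: (@cvgn_normr_le _ _ (qpoch_inf x q)^-1).
apply: cvgV; last exact: qpoch_inf_cvg.
by apply: qpoch_inf_neq0 => // n; exact: qpoch_neq0.
Qed.

Lemma abs_summable_mulrnX (K : numFieldType) (r : K) : 0 <= r -> r < 1 ->
  abs_summable (fun n => n.+1%:R * r ^+ n).
Proof.
move=> r0 r1; have d0 : 0 < 1 - r by rewrite subr_gt0.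
exists ((1 - r) ^+ 2)^-1 => N.
rewrite -[leRHS]mul1r ler_pdivlMr ?exprn_gt0 //.
(* Closed form of the differentiated geometric sum; the subtracted remainder is nonnegative. *)
have -> : series (fun n => `|n.+1%:R * r ^+ n|) N * (1 - r) ^+ 2 =
    1 - (r ^+ N + N%:R * r ^+ N * (1 - r)).
  elim: N => [|N IH]; first by rewrite /series /= big_geq // expr0 mulr0n !mul0r addr0 subrr.
  rewrite seriesSr mulrDl IH ger0_norm ?mulr_ge0 ?exprn_ge0 ?ler0n //.
  by rewrite -!natr1 [r ^+ N.+1]exprS; ring.
by rewrite gerBl addr_ge0 ?mulr_ge0 ?exprn_ge0 ?ler0n // ltW.
Qed.

(** With r = max(|a|, |b|), each of the n+1 terms of [rs_sum] is O(r^n), and its prefactor is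
    bounded; this leaves a multiple of (n+1) r^n. *)
Lemma rs_coef_abs_summable (R : realType) (q a b : Cplx R) :
  `|q| < 1 -> `|a| < 1 -> `|b| < 1 -> abs_summable (rs_coef q a b).
Proof.
move=> q1 a1 b1.
have p1 : `|q ^+ 2| < 1 by rewrite normrX exprn_ilt1.
have [r [r0 r1 ar br]] : exists r : Cplx R, [/\ 0 <= r, r < 1, `|a| <= r & `|b| <= r].
  have [ab|/ltW ba] := real_leP (normr_real a) (normr_real b).
    by exists `|b|; rewrite lexx.
  by exists `|a|; rewrite lexx.
have [B hB] := qpoch_inv_bounded p1 p1.
have [C hC] := cvgn_normr_le (@qpoch_inf_cvg R (- q) q q1).
have B0 : 0 <= B by apply: le_trans (hB 0%N).
have C0 : 0 <= C by apply: le_trans (hC 0%N).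
have d0 : 0 < 1 - `|q| by rewrite subr_gt0.
have inv_le n : `|(1 + q ^+ n)^-1| <= (1 - `|q|)^-1.
  rewrite normfV lef_pV2 ?posrE ?normr_gt0 ?add1X_neq0 //.
  (* At n = 0 the lower bound 1 - |q^n| degenerates to 0, but there 1 + q^0 = 2. *)
  case: n => [|n].
    rewrite expr0 -[1 + 1]/(2%:R) normr_nat; apply: le_trans (_ : 1 <= _).
      by rewrite gerBl.
    by rewrite ler1n.
  apply: le_trans (_ : 1 - `|q ^+ n.+1| <= _).
    rewrite lerB // normrX exprS ler_piMr // exprn_ile1 // ltW //.
  by have := lerB_dist 1 (- q ^+ n.+1); rewrite normr1 normrN opprK.
(* [C] bounds (-q;q)_n, the inverse bounds 1/(1 + q^n), 2 bounds q^k + q^(n-k), and [B] bounds each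
   of the two reciprocal products. *)
pose D := C * (1 - `|q|)^-1 * (2 * B ^+ 2).
apply: (@abs_summable_le _ _ (fun n => D * (n.+1%:R * r ^+ n))); last first.
  exact/abs_summableZ/abs_summable_mulrnX.
move=> n; have D0 : 0 <= D.
  have i0 : 0 <= (1 - `|q|)^-1 by rewrite invr_ge0 ltW.
  by rewrite /D; do ?apply: mulr_ge0 => //; apply: exprn_ge0.
rewrite [leRHS]ger0_norm; last by do ?apply: mulr_ge0 => //; apply: exprn_ge0.
rewrite rs_coefE // normrM normrM /D -[leRHS]mulrA.
apply: ler_pM; [exact: mulr_ge0|exact: normr_ge0| |].
  by apply: ler_pM => //; exact: inv_le.
rewrite /rs_sum; apply: le_trans (ler_norm_sum _ _ _) _.
apply: le_trans (_ : \sum_(k < n.+1) 2 * B ^+ 2 * r ^+ n <= _); last first.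
  by rewrite sumr_const card_ord -[leLHS]mulr_natl [leLHS]mulrCA lexx.
apply: ler_sum => k _.
have -> : r ^+ n = r ^+ k * r ^+ (n - k) by rewrite -exprD subnKC // -ltnS.
rewrite invfM.
set x := qpoch _ _ k; set y := qpoch _ _ (n - k).
rewrite !normrM.
have -> : 2 * B ^+ 2 * (r ^+ k * r ^+ (n - k)) = 2 * r ^+ k * r ^+ (n - k) * (B * B) by ring.
apply: ler_pM; rewrite ?mulr_ge0 //; last by apply: ler_pM => //; exact: hB.
apply: ler_pM; rewrite ?mulr_ge0 //; last by rewrite normrX lerXn2r ?nnegrE.
apply: ler_pM => //; last by rewrite normrX lerXn2r ?nnegrE.
apply: le_trans (ler_normD _ _) _; rewrite -[leRHS]/(1 + 1).
by apply: lerD; rewrite normrX exprn_ile1 // ltW.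
Qed.

(** * Functional equation of the generating function phi *)

Lemma psum_rs_shift (R : realType) (q a b t : Cplx R) :
  q != 0 -> `|q| < 1 -> `|a| < 1 -> `|b| < 1 -> `|t| <= 1 ->
  (1 - a * b * t ^+ 2) * psum (rs_coef q a b) (q * t) =
    (1 - a * t) * (1 - b * t) * psum (rs_coef q a b) t.
Proof.
move=> q0 q1 a1 b1 t1; have hH := rs_coef_abs_summable q1 a1 b1.
have qt1 : `|q * t| <= 1 by rewrite normrM mulr_ile1 // ltW.
set H := rs_coef q a b in hH *.
pose S s N := series (fun n => H n * s ^+ n) N.
have SS s N : S s N.+1 = S s N + H N * s ^+ N by exact: seriesSr.
have S0 s : S s 0%N = 0 by rewrite /S /series /= big_geq.
(* The expanded functional equation on partial sums, cut at [N], [N.+1] or [N.+2] according to the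
   power of [t] in front; this makes it vanish exactly. *)
pose T N := S t N.+2 - (a + b) * t * S t N.+1 + a * b * t ^+ 2 * (S t N + S (q * t) N)
    - S (q * t) N.+2.
have T0 : T = fun=> 0.
  apply/funext; elim=> [|N IH].
    rewrite /T !SS !S0 !expr0 !expr1 !mulr1.
    have := rs_coef1 a b q1; have := rs_coef0 a b q1; rewrite -/H => -> h1.
    transitivity (((1 - q) * H 1%N - (a + b)) * t); first by ring.
    by rewrite h1 subrr mul0r.
  have := rs_coef_rec a b N q0 q1; rewrite -/H => hS.
  (* The increment of [T] is the recurrence for [H] times t^(N+2). *)
  transitivity (T N + ((1 - q ^+ N.+2) * H N.+2 - ((a + b) * H N.+1
      - a * b * (1 + q ^+ N) * H N)) * t ^+ N.+2).
    by rewrite /T !SS !exprMn !exprS; ring.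
  by rewrite IH hS subrr mul0r addr0.
have h1 : S t n @[n --> \oo] --> psum H t by exact: psum_cvg.
have h2 : S (q * t) n @[n --> \oo] --> psum H (q * t) by exact: psum_cvg.
have hl : T N @[N --> \oo] --> psum H t - (a + b) * t * psum H t
      + a * b * t ^+ 2 * (psum H t + psum H (q * t)) - psum H (q * t).
  apply: cvgB; last exact: (cvgnS (cvgnS h2)).
  apply: cvgD; first apply: cvgB; first exact: (cvgnS (cvgnS h1)).
    by apply: cvgM; [exact: cvg_cst|exact: (cvgnS h1)].
  by apply: cvgM; [exact: cvg_cst|exact: (cvgD h1 h2)].
have hz : psum H t - (a + b) * t * psum H t
      + a * b * t ^+ 2 * (psum H t + psum H (q * t)) - psum H (q * t) = 0.
  by apply: (cvgn_eq hl); rewrite T0; exact: cvg_cst.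
move: hz; move: (psum H t) (psum H (q * t)) => y z hz.
apply/eqP; rewrite -subr_eq0; apply/eqP; rewrite -[RHS]oppr0 -hz; ring.
Qed.

Lemma psum_rs_qpoch (R : realType) (q a b : Cplx R) n :
  q != 0 -> `|q| < 1 -> `|a| < 1 -> `|b| < 1 ->
  qpoch (a * b) (q ^+ 2) n * psum (rs_coef q a b) (q ^+ n) =
    qpoch a q n * qpoch b q n * psum (rs_coef q a b) 1.
Proof.
move=> q0 q1 a1 b1; elim: n => [|n IH]; first by rewrite !qpoch0 !mul1r expr0.
have qn1 : `|q ^+ n| <= 1 by rewrite normrX exprn_ile1 // ltW.
have := psum_rs_shift q0 q1 a1 b1 qn1; rewrite -exprS -exprM => hs.
rewrite !qpochS -exprM [(2 * n)%N]mulnC -mulrA hs.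
transitivity ((1 - a * q ^+ n) * (1 - b * q ^+ n) *
  (qpoch (a * b) (q ^+ 2) n * psum (rs_coef q a b) (q ^+ n))); first by ring.
by rewrite IH; ring.
Qed.

(** * Exchange of summations, the value of phi(1), and the final identity *)

Lemma abs_summableM_bounded (K : numFieldType) (u v : nat -> K) (B : K) :
  (forall n, `|v n| <= B) -> abs_summable u -> abs_summable (fun n => u n * v n).
Proof.
move=> hB hu; apply: (@abs_summable_le _ _ (fun n => B * u n)); last exact: abs_summableZ.
have B0 : 0 <= B by apply: le_trans (hB 0%N).
by move=> n; rewrite !normrM mulrC (ger0_norm B0) ler_wpM2r.
Qed.

(** Both sides sum w_n u_m q^(nm). Truncating in n permits the exchange, and the truncation is
    removed by dominated convergence, with a bound for the sums of |w_n| times |u_m| as majorant. *)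
Lemma psum_exchange (R : realType) (w u : nat -> Cplx R) (q : Cplx R) :
  abs_summable w -> abs_summable u -> `|q| <= 1 ->
  series (fun n => w n * psum u (q ^+ n)) n @[n --> \oo] -->
    limn (series (fun m => u m * psum w (q ^+ m))).
Proof.
move=> hw hu q1.
have qX n : `|q ^+ n| <= 1 by rewrite normrX exprn_ile1.
pose S m N := series (fun n => w n * (q ^+ m) ^+ n) N.
have inner N : series (fun m => u m * S m N) M @[M --> \oo] -->
    series (fun n => w n * psum u (q ^+ n)) N.
  elim: N => [|N IH].
    rewrite [series _ 0%N]big_geq //.
    rewrite (_ : (fun M => _) = fun=> 0); first exact: cvg_cst.
    by apply/funext => M; apply: big1 => m _; rewrite /S /series /= big_geq // mulr0.
  rewrite seriesSr (_ : (fun M => _) = (fun M => series (fun m => u m * S m N) M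
      + series (fun m => w N * (u m * (q ^+ N) ^+ m)) M)).
    by apply: cvgD IH _; apply: cvg_seriesZ; exact: psum_cvg.
  apply/funext => M; rewrite /series /= -big_split; apply: eq_bigr => m _ /=.
  by rewrite /S seriesSr -!exprM [(N * m)%N]mulnC; ring.
have [B hB] := hw.
have B0 : 0 <= B by have := hB 0%N; rewrite /series /= big_geq.
have hS m N : `|S m N| <= B.
  apply: le_trans (hB N); apply: le_trans (ler_norm_sum _ _ _) _.
  by apply: ler_sum => n _; exact: norm_mulX_le.
have -> : series (fun n => w n * psum u (q ^+ n)) =
    fun N => limn (series (fun m => u m * S m N)).
  by apply/funext => N; symmetry; apply: cvgn_lim; exact: inner.
apply: (@dominated_cvg_limn_series _ (fun N m => u m * S m N) _ (fun m => B * u m)).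
- exact: abs_summableZ.
- by move=> N m; rewrite !normrM mulrC (ger0_norm B0) ler_wpM2r.
- by move=> m; apply: cvgM; [exact: cvg_cst|exact: psum_cvg].
Qed.

(** The limit of (ab;q^2)_n phi(q^n) is computed twice: from phi(q^n) --> H_0 = 1, and from the
    iterated functional equation. *)
Lemma psum_rs1 (R : realType) (q a b : Cplx R) :
  q != 0 -> `|q| < 1 -> `|a| < 1 -> `|b| < 1 ->
  qpoch_inf a q * qpoch_inf b q * psum (rs_coef q a b) 1 =
    qpoch_inf (a * b) (q ^+ 2).
Proof.
move=> q0 q1 a1 b1; have p1 : `|q ^+ 2| < 1 by rewrite normrX exprn_ilt1.
set H := rs_coef q a b.
have h1 : qpoch (a * b) (q ^+ 2) n * psum H (q ^+ n) @[n --> \oo] -->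
    qpoch_inf (a * b) (q ^+ 2) * 1.
  apply: cvgM; first exact: qpoch_inf_cvg.
  rewrite -(rs_coef0 a b q1); apply: psum_cvg0 => //.
  exact: rs_coef_abs_summable.
rewrite mulr1 in h1; symmetry; apply: (cvgn_eq h1).
under eq_fun do rewrite psum_rs_qpoch //.
apply: cvgM; last exact: cvg_cst.
by apply: cvgM; exact: qpoch_inf_cvg.
Qed.

Unset Implicit Arguments.

Theorem theorem1p3 (R : realType) (q a b c : Cplx R)
    (q_gt0 : 0 < `|q|) (q_lt1 : `|q| < 1)
    (a_lt1 : `|a| < 1) (b_lt1 : `|b| < 1)
    (c_neq : forall j : nat, c != - q ^- j.+1) :
  let F (n : nat) : Cplx R :=
    qpoch a q n * qpoch b q n / (qpoch q q n * qpoch (a * b) (q ^+ 2) n)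
      * q ^+ (n * n.+1)./2 * c ^+ n in
  let G (n : nat) : Cplx R :=
    (rogers_szego n a (b * q) (q ^+ 2) + rogers_szego n (a * q) b (q ^+ 2))
      / (qpoch q q n * qpoch (- c * q) q n * (1 + q ^+ n)) in
  [/\ cvgn (series F), cvgn (series G)
    & limn (series F) =
        qpoch_inf a q * qpoch_inf b q * qpoch_inf (- c * q) q
          / qpoch_inf (a * b) (q ^+ 2) * limn (series G)].
Proof.
move=> F G; have q0 : q != 0 by rewrite -normr_gt0.
have p1 : `|q ^+ 2| < 1 by rewrite normrX exprn_ilt1.
have ab1 : `|a * b| < 1 by rewrite normrM mulr_ilt1.
set x := - c * q; set w := euler_coef x q; set H := rs_coef q a b.
(* The hypothesis on [c] says that no factor 1 + c q^(j+1) vanishes; |x| may exceed 1, so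
   [qpoch_neq0] does not apply. *)
have xn0 n : qpoch x q n != 0.
  apply/prodf_neq0 => j _; apply/negP; rewrite subr_eq0 => /eqP h.
  have := c_neq j; rewrite -(mulfK (expf_neq0 j.+1 q0) c).
  have -> : c * q ^+ j.+1 = -1 by rewrite h /x exprS; ring.
  by rewrite mulN1r eqxx.
have hw : abs_summable w by exact: euler_coef_abs_summable.
have hH : abs_summable H by exact: rs_coef_abs_summable.
have E1 : qpoch_inf x q = psum w 1 by exact: qpoch_infE.
have E0 : psum w 1 != 0 by rewrite -E1; exact: qpoch_inf_neq0.
have ab0 : qpoch_inf (a * b) (q ^+ 2) != 0.
  by apply: qpoch_inf_neq0 => // n; exact: qpoch_neq0.
have phi := psum_rs1 q0 q_lt1 a_lt1 b_lt1; rewrite -/H in phi.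
have phi0 : psum H 1 != 0.
  by apply: contraNneq ab0 => h; rewrite -phi h mulr0.
have FE : F = fun n => (psum H 1)^-1 * (w n * psum H (q ^+ n)).
  apply/funext => n; have hn := psum_rs_qpoch n q0 q_lt1 a_lt1 b_lt1.
  have abn0 : qpoch (a * b) (q ^+ 2) n != 0 by exact: qpoch_neq0.
  have qn0 : qpoch q q n != 0 by exact: qpoch_neq0.
  have -> : psum H (q ^+ n) =
      qpoch a q n * qpoch b q n * psum H 1 / qpoch (a * b) (q ^+ 2) n.
    by rewrite -hn mulrC mulKf.
  (* Since [x] is -cq, (-x)^n supplies c^n and the q^n missing from q^C(n,2). *)
  have tri : (n * n.+1)./2 = ('C(n, 2) + n)%N.
    by rewrite mulnC -(bin2 n.+1) binS bin1.
  rewrite /F /w /euler_coef /x tri exprD mulNr opprK exprMn.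
  by field; rewrite abn0 qn0 phi0.
have GE : G = fun n => (psum w 1)^-1 * (H n * psum w (q ^+ n)).
  apply/funext => n; have hn := psum_euler_qpoch x n q_lt1; rewrite -/w in hn.
  have qn0 : qpoch q q n != 0 by exact: qpoch_neq0.
  have -> : psum w (q ^+ n) = psum w 1 / qpoch x q n.
    by apply: (canRL (mulfK (xn0 n))); rewrite mulrC hn.
  have hq := add1X_neq0 n q_lt1; have hx := xn0 n.
  rewrite /G /H /rs_coef -/x.
  by field; rewrite hq hx qn0 E0.
have [B hB] := cvgn_normr_le (psum_euler_cvg1 x q_lt1).
have cL : series (fun n => H n * psum w (q ^+ n)) n @[n --> \oo] -->
    limn (series (fun n => H n * psum w (q ^+ n))).
  exact: abs_summable_cvgn (abs_summableM_bounded hB hH).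
(* The exchange gives both series the same limit up to the constants 1/phi(1) and 1/E(1). *)
have cF := cvg_seriesZ (k := (psum H 1)^-1) (psum_exchange hw hH (ltW q_lt1)).
have cG := cvg_seriesZ (k := (psum w 1)^-1) cL.
rewrite -FE in cF; rewrite -GE in cG.
split; [by apply/cvg_ex; eexists; exact: cF|by apply/cvg_ex; eexists; exact: cG|].
rewrite (cvgn_lim cF) (cvgn_lim cG) E1 -phi.
(* (a;q)_oo and (b;q)_oo are factors of the nonzero (ab;q^2)_oo in the formula for phi(1). *)
have a0 : qpoch_inf a q != 0 by apply: contraNneq ab0 => h; rewrite -phi h !mul0r.
have b0 : qpoch_inf b q != 0 by apply: contraNneq ab0 => h; rewrite -phi h mulr0 mul0r.
move: (limn _) (qpoch_inf a q) (qpoch_inf b q) (psum w 1) (psum H 1)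
  a0 b0 E0 phi0 => L Pa Pb Px Ph Pa0 Pb0 Px0 Ph0.
by field; rewrite Pa0 Pb0 Px0 Ph0.
Qed.
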